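(* Let $\mathbf{A}=[\underline A,\overline A]\subseteq\mathbb{R}^{m\times n}$ be an interval matrix and $\mathbf{b}=[\underline b,\overline b]\subseteq\mathbb{R}^m$, $\mathbf{c}=[\underline c,\overline c]\subseteq\mathbb{R}^n$ interval vectors. The type (B) interval linear program $\min\{\mathbf{c}^{\top}x : \mathbf{A}x\le\mathbf{b}\}$ has weakly zero duality gap if and only if at least one of the following conditions holds: (i) there exists $p\in\{\pm1\}^n$ such that the linear system $(A_c-A_\Delta\,\mathrm{diag}(p))\,x\le\overline{b}$ is feasible; (ii) the linear system $\overline{A}^{\top}y\le\overline{c},\ \underline{A}^{\top}y\ge\underline{c},\ y\le 0$ is feasible.
   Context: For real matrices $\underline{A}\le\overline{A}$ (entrywise), $\mathbf{A}=[\underline{A},\overline{A}]=\{A:\underline{A}\le A\le\overline{A}\}$; interval vectors are defined analogously. $A_c=\frac12(\underline A+\overline A)$ is the center matrix, $A_\Delta=\frac12(\overline A-\underline A)$ the radius matrix, and $\mathrm{diag}(p)$ is the diagonal matrix with diagonal entries the entries of $p$. The type (B) interval linear program is the family of linear programs $\min\{c^{\top}x: Ax\le b\}$ over all scenarios $(A,b,c)$ with $A\in\mathbf{A}$, $b\in\mathbf{b}$, $c\in\mathbf{c}$. The dual of the scenario $(A,b,c)$ is $\max\{b^{\top}y: A^{\top}y=c,\ y\le 0\}$. A scenario has zero duality gap if and only if at least one of its primal and dual linear programs is feasible (otherwise the duality gap is $\infty$). The duality gap of the interval linear program is weakly zero if at least one scenario has zero duality gap. *)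

(* Defs.v *)
From mathcomp Require Import all_boot all_order all_algebra.
From mathcomp Require Import all_classical all_reals all_analysis.

Set Implicit Arguments.
Unset Strict Implicit.
Unset Printing Implicit Defensive.

Import Order.TTheory GRing.Theory Num.Theory.

Local Open Scope classical_set_scope.
Local Open Scope ring_scope.

Definition mx_le (R : realType) (m n : nat) (A B : 'M[R]_(m, n)) : Prop :=
  forall i j, A i j <= B i j.

Definition mx_interval (R : realType) (m n : nat) (lo hi : 'M[R]_(m, n)) :
  set 'M[R]_(m, n) := [set X | mx_le lo X /\ mx_le X hi].

Definition mx_center (R : realType) (m n : nat) (lo hi : 'M[R]_(m, n)) :
  'M[R]_(m, n) := 2^-1 *: (lo + hi).

Definition mx_radius (R : realType) (m n : nat) (lo hi : 'M[R]_(m, n)) :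
  'M[R]_(m, n) := 2^-1 *: (hi - lo).

Definition dot (R : realType) (n : nat) (u v : 'cV[R]_n) : R :=
  (u^T *m v) 0 0.

Definition primal_feasible (R : realType) (m n : nat)
  (A : 'M[R]_(m, n)) (b : 'cV[R]_m) : set 'cV[R]_n :=
  [set x | mx_le (A *m x) b].

Definition dual_feasible (R : realType) (m n : nat)
  (A : 'M[R]_(m, n)) (c : 'cV[R]_n) : set 'cV[R]_m :=
  [set y | A^T *m y = c /\ mx_le y 0].

(* Optimal values are extended reals: the infimum over an empty feasible set
   is +oo and the supremum over an empty feasible set is -oo. *)
Definition primal_value (R : realType) (m n : nat)
  (A : 'M[R]_(m, n)) (b : 'cV[R]_m) (c : 'cV[R]_n) : \bar R :=
  ereal_inf [set (dot c x)%:E | x in primal_feasible A b].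

Definition dual_value (R : realType) (m n : nat)
  (A : 'M[R]_(m, n)) (b : 'cV[R]_m) (c : 'cV[R]_n) : \bar R :=
  ereal_sup [set (dot b y)%:E | y in dual_feasible A c].

(* The gap between equal optimal values is 0 also when both are infinite, a
   case in which the subtraction of the library does not give 0.  If both
   programs are infeasible the gap is +oo - (-oo) = +oo. *)
Definition duality_gap (R : realType) (m n : nat)
  (A : 'M[R]_(m, n)) (b : 'cV[R]_m) (c : 'cV[R]_n) : \bar R :=
  if primal_value A b c == dual_value A b c then 0%E
  else (primal_value A b c - dual_value A b c)%E.

Definition weakly_zero_duality_gap (R : realType) (m n : nat)
  (Alo Ahi : 'M[R]_(m, n)) (blo bhi : 'cV[R]_m) (clo chi : 'cV[R]_n) : Prop :=
  exists A b c, [/\ mx_interval Alo Ahi A, mx_interval blo bhi b,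
    mx_interval clo chi c & duality_gap A b c = 0%E].

(* Main.v *)
Require Import Defs.
From mathcomp Require Import all_boot all_order all_algebra.
From mathcomp Require Import all_classical all_reals all_analysis.
From mathcomp Require Import ring lra.

(** By LP duality a scenario has zero gap exactly when its primal or its dual
    is feasible ([duality_gap_eq0]), so the gap is weakly zero iff some
    scenario is primal feasible or some scenario is dual feasible.  The primal
    depends only on (A, b) and the dual only on (A, c), so the remaining data
    are free and the two alternatives can be described separately.

    Primal ([weak_primal_feasible]): for fixed x the smallest value of A x over
    the interval matrix is A_c x - A_Delta |x|, attained row by row at the same
    vertex A_c - A_Delta diag(p) with p the sign vector of x; and the weakest
    right-hand side is the upper bound of b.

    Dual ([weak_dual_feasible]): for fixed y <= 0 the values of A^T y fill the
    whole box [Ahi^T y, Alo^T y], since the columns of A vary independently and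
    each is moved along a segment.  The system (ii) says that this box meets
    [clo, chi].

    Strong duality, with optimal values in the extended reals, rests on
    Farkas' lemma, which is obtained by Fourier-Motzkin elimination.  Farkas'
    lemma is applied to Ax <= b together with the level constraint c^T x <= r:
    once either program is feasible, every real r is at least some primal
    objective value or at most some dual one ([lp_alternative]).  No
    real number can then separate the two optimal values. *)

Set Implicit Arguments.
Unset Strict Implicit.
Unset Printing Implicit Defensive.

Import Order.TTheory GRing.Theory Num.Theory.

Local Open Scope ring_scope.

(** * Farkas' lemma *)

Lemma mulmx_le (R : realFieldType) (k m n : nat) (L : 'M[R]_(k, m))
    (X Y : 'M[R]_(m, n)) :
  (forall i j, 0 <= L i j) -> (forall i j, X i j <= Y i j) ->
  forall i j, (L *m X) i j <= (L *m Y) i j.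
Proof.
by move=> L0 XY i j; rewrite !mxE; apply: ler_sum => s _; apply: ler_wpM2l.
Qed.

(** Elimination of one variable t from the system a t <= v.  The rows of M are
    nonnegative combinations that cancel a, so M v >= 0 is necessary; it is
    sufficient because it says that each lower bound on t (from a negative
    coefficient) is below each upper bound (from a positive one).  M depends on
    a alone, which allows v to be affine in the variables still present. *)
Lemma fourier_motzkin (R : realFieldType) (m : nat) (a : 'cV[R]_m) :
  exists k (M : 'M[R]_(k, m)),
    [/\ forall i j, 0 <= M i j, M *m a = 0 &
      forall v : 'cV[R]_m, (forall i, 0 <= (M *m v) i 0) ->
        exists t, forall i, a i 0 * t <= v i 0].
Proof.
pose w (s : 'I_m * 'I_m) : 'rV[R]_m :=
  if (0 < a s.1 0) && (a s.2 0 < 0)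
  then - a s.2 0 *: delta_mx 0 s.1 + a s.1 0 *: delta_mx 0 s.2
  else if a s.1 0 == 0 then delta_mx 0 s.1 else 0.
(* Besides the crossing rows (a_i > 0 > a_k), the rows that do not involve t
   are kept; every other pair of indices gives a zero row. *)
pose M := \matrix_(i < #|{: 'I_m * 'I_m}|) w (enum_val i).
have dE (i : 'I_m) (v : 'cV[R]_m) : ((delta_mx 0 i : 'rV_m) *m v) 0 0 = v i 0.
  by rewrite -rowE mxE.
have ME (v : 'cV[R]_m) s : (M *m v) (enum_rank s) 0 = (w s *m v) 0 0.
  have -> : w s = row (enum_rank s) M by rewrite rowK enum_rankK.
  by rewrite -row_mul [RHS]mxE.
exists #|{: 'I_m * 'I_m}|, M; split.
- move=> i j; rewrite mxE /w; case: ifP => [/andP[p1 p2]|_].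
    rewrite !mxE; apply: addr_ge0; apply: mulr_ge0; rewrite ?ler0n //; lra.
  by case: ifP; rewrite !mxE // ler0n.
- apply/matrixP => i j; rewrite [j]ord1 -(enum_valK i) ME /w [RHS]mxE.
  case: ifP => _; last first.
    by case: eqP => [<-|_]; rewrite ?dE // mul0mx mxE.
  by rewrite mulmxDl -!scalemxAl 2!mxE [X in _ + X]mxE !dE; ring.
move=> v Mv.
have v_eq0 i : a i 0 = 0 -> 0 <= v i 0.
  move=> ai0; have := Mv (enum_rank (i, i)).
  by rewrite ME /w /= ai0 ltxx eqxx /= dE.
have v_cross i k : 0 < a i 0 -> a k 0 < 0 -> v k 0 / a k 0 <= v i 0 / a i 0.
  move=> ai ak; have := Mv (enum_rank (i, k)).
  rewrite ME /w /= ai ak /= mulmxDl -!scalemxAl 2!mxE [X in _ + X]mxE !dE => h.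
  by rewrite ler_pdivlMr // mulrAC ler_ndivrMr //; lra.
suff [t tlo thi] : exists2 t,
    forall k, a k 0 < 0 -> v k 0 / a k 0 <= t &
    forall i, 0 < a i 0 -> t <= v i 0 / a i 0.
  exists t => i; case: (ltgtP (a i 0) 0) => [ai|ai|ai].
  - by have := tlo i ai; rewrite ler_ndivrMr // mulrC.
  - by have := thi i ai; rewrite ler_pdivlMr // mulrC.
  - by rewrite ai mul0r v_eq0.
case: (pickP (fun k => a k 0 < 0)) => [k0 ak0|noneg].
  case: (@arg_maxP _ R _ k0 (fun k => a k 0 < 0) (fun k => v k 0 / a k 0) ak0) => k ak kmax.
  by exists (v k 0 / a k 0) => [//|i ai]; exact: v_cross.
case: (pickP (fun k => 0 < a k 0)) => [k0 ak0|nopos].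
  case: (@arg_minP _ R _ k0 (fun k => 0 < a k 0) (fun k => v k 0 / a k 0) ak0) => k ak kmin.
  by exists (v k 0 / a k 0) => [i|//]; rewrite noneg.
by exists 0 => i; rewrite ?noneg ?nopos.
Qed.

(** Induction on the number of variables: eliminating the first one replaces
    (A, b) by (M A', M b), and an infeasibility certificate y of the reduced
    system becomes the certificate y M of the original one, because M is
    nonnegative and cancels the eliminated column. *)
Lemma farkas (R : realFieldType) (m n : nat) (A : 'M[R]_(m, n)) (b : 'cV[R]_m) :
  (exists x : 'cV[R]_n, forall i, (A *m x) i 0 <= b i 0) \/
  (exists y : 'rV[R]_m,
    [/\ forall i, 0 <= y 0 i, y *m A = 0 & (y *m b) 0 0 < 0]).
Proof.
elim: n m A b => [|n IH] m A b.
  case: (pickP (fun i => b i 0 < 0)) => [i bi|b0].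
    right; exists (delta_mx 0 i); split => [j||].
    + by rewrite mxE ler0n.
    + by rewrite [LHS]thinmx0.
    + by rewrite -rowE mxE.
  left; exists 0 => i; rewrite mulmx0 mxE leNgt; exact/negbT/b0.
rewrite -[n.+1]/(1 + n)%N in A *.
have [k [M [M0 Ma Mt]]] := fourier_motzkin (lsubmx A).
have [[x hx]|[y [y0 yA yb]]] := IH _ (M *m rsubmx A) (M *m b); [left|right].
  have [i|t ht] := Mt (b - rsubmx A *m x).
    by rewrite mulmxBr mulmxA !mxE subr_ge0; move: (hx i); rewrite !mxE.
  exists (col_mx t%:M x) => i.
  rewrite -{1}[A]hsubmxK mul_row_col mul_mx_scalar.
  by move: (ht i); rewrite [_ 0 in X in _ <= X]mxE; rewrite !mxE; lra.
exists (y *m M); split.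
- by move=> i; rewrite mxE; apply: sumr_ge0 => j _; apply: mulr_ge0.
- rewrite -[A]hsubmxK mul_mx_row -[y *m M *m rsubmx A]mulmxA yA.
  by rewrite -mulmxA Ma mulmx0 row_mx0.
- by rewrite -mulmxA.
Qed.

(** * Strong duality *)

Lemma dot_trmx (R : realType) (n : nat) (b : 'cV[R]_n) (u : 'rV[R]_n) :
  dot b u^T = (u *m b) 0 0.
Proof. by rewrite /dot -trmx_mul mxE. Qed.

Lemma dotDr (R : realType) (n : nat) (b u v : 'cV[R]_n) :
  dot b (u + v) = dot b u + dot b v.
Proof. by rewrite /dot mulmxDr mxE. Qed.

Lemma dotZr (R : realType) (n : nat) (b u : 'cV[R]_n) (s : R) :
  dot b (s *: u) = s * dot b u.
Proof. by rewrite /dot -scalemxAr mxE. Qed.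

Lemma weak_duality (R : realType) (m n : nat) (A : 'M[R]_(m, n))
    (b : 'cV[R]_m) (c x : 'cV[R]_n) (y : 'cV[R]_m) :
  primal_feasible A b x -> dual_feasible A c y -> dot b y <= dot c x.
Proof.
move=> Axb [<- y0].
have y0' i j : 0 <= (- y^T) i j by move: (y0 j i); rewrite !mxE oppr_ge0.
have := mulmx_le y0' Axb 0 0; rewrite !mulNmx mxE [X in _ <= X]mxE lerN2.
by rewrite -(dot_trmx b) trmxK [dot (_ *m _) _]/dot trmx_mul trmxK -mulmxA.
Qed.

(** If Ax <= b and c^T x <= r are incompatible, Farkas gives u, s >= 0 with
    u A + s c^T = 0 and u b + s r < 0.  For s > 0, rescaling u by -1/s is dual
    feasible with value above r.  For s = 0, u refutes the primal on its own,
    so the dual is the feasible one, and -u is a direction along which its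
    objective is unbounded. *)
Lemma lp_alternative (R : realType) (m n : nat) (A : 'M[R]_(m, n))
    (b : 'cV[R]_m) (c : 'cV[R]_n) (r : R) :
  (exists x, primal_feasible A b x) \/ (exists y, dual_feasible A c y) ->
  (exists2 x, primal_feasible A b x & dot c x <= r) \/
  (exists2 y, dual_feasible A c y & r <= dot b y).
Proof.
move=> feas.
have [[x hx]|[y [y0]]] := farkas (col_mx A c^T) (col_mx b r%:M).
  left; exists x => [i j|].
    by rewrite [j]ord1; have := hx (lshift 1 i); rewrite mul_col_mx !col_mxEu.
  by have := hx (rshift m 0); rewrite mul_col_mx !col_mxEd [X in _ <= X]mxE.
rewrite -[y]hsubmxK !mul_row_col [rsubmx y]mx11_scalar !mul_scalar_mx.
set u := lsubmx y; set s := rsubmx y 0 0 => uA ub.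
have {ub} : (u *m b) 0 0 + s * r < 0 by move: ub; rewrite !mxE.
set d := (u *m b) 0 0 => ub.
have u0 i j : 0 <= u i j by rewrite [i]ord1 mxE.
have s0 : 0 <= s by rewrite /s mxE.
have {uA} uA : u *m A = - s *: c^T by rewrite scaleNr; apply/eqP; rewrite -addr_eq0 uA.
right; case: (ltgtP s 0) => [|s_gt0|sE]; first by rewrite ltNge s0.
  exists (- s^-1 *: u^T); first split.
  - by rewrite -scalemxAr -trmx_mul uA linearZ /= trmxK scalerA mulrNN mulVf
      ?scale1r// gt_eqF.
  - by move=> i j; rewrite [j]ord1 !mxE mulNr oppr_le0; apply: mulr_ge0; rewrite ?invr_ge0.
  - rewrite dotZr dot_trmx -/d mulNr mulrC -mulNr ler_pdivlMr //; lra.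
rewrite {}sE oppr0 scale0r in uA ub.
have d0 : d < 0 by lra.
case: feas => [[x Ax]|[y1 [Ay1 y10]]].
  have := mulmx_le u0 Ax 0 0.
  by rewrite mulmxA uA mul0mx mxE leNgt -/d d0.
pose k := `|r - dot b y1| / - d.
have k0 : 0 <= k by rewrite divr_ge0 // oppr_ge0 ltW.
have kd : k * d = - `|r - dot b y1|.
  by rewrite /k invrN mulrN mulNr mulfVK ?lt_eqF.
exists (y1 + - k *: u^T); first split.
- by rewrite mulmxDr Ay1 -scalemxAr -trmx_mul uA trmx0 scaler0 addr0.
- move=> i j; move: (y10 i j) (mulr_ge0 k0 (u0 j i)); rewrite !mxE; lra.
- rewrite dotDr dotZr dot_trmx -/d mulNr kd opprK.
  have := ler_norm (r - dot b y1); lra.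
Qed.

Lemma strong_duality (R : realType) (m n : nat) (A : 'M[R]_(m, n))
    (b : 'cV[R]_m) (c : 'cV[R]_n) :
  (exists x, primal_feasible A b x) \/ (exists y, dual_feasible A c y) ->
  primal_value A b c = dual_value A b c.
Proof.
move=> feas; apply/eqP; rewrite eq_le; apply/andP; split; last first.
  apply: ge_ereal_sup => _ [y Dy <-]; apply: le_ereal_inf_tmp => _ [x Px <-].
  by rewrite lee_fin; exact: weak_duality Px Dy.
(* Each real r is an upper bound of the primal value or a lower bound of the
   dual value, so none lies strictly between them. *)
have le_level r : (primal_value A b c <= r%:E \/ r%:E <= dual_value A b c)%E.
  have [[x Px cx]|[y Dy ry]] := lp_alternative r feas; [left|right].
    by apply: ge_ereal_inf; exists (dot c x)%:E; [exists x | rewrite lee_fin].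
  by apply: le_ereal_sup_tmp; exists (dot b y)%:E; [exists y | rewrite lee_fin].
rewrite leNgt; apply/negP.
move: (primal_value A b c) (dual_value A b c) le_level => p d lvl dp.
have [r dr rp] : exists2 r, (d < r%:E)%E & (r%:E < p)%E.
  case: p d dp {lvl} => [p| |] [d| |] //= dp.
  - exists ((p + d) / 2); rewrite lte_fin; move: dp; rewrite lte_fin; lra.
  - by exists (p - 1); rewrite ?ltNyr// lte_fin; lra.
  - by exists (d + 1); rewrite ?ltry// lte_fin; lra.
  - by exists 0; rewrite ?ltNyr ?ltry.
by case: (lvl r); rewrite leNgt ?dr ?rp.
Qed.

(** When both programs are infeasible the values are +oo and -oo, so the gap is
    +oo; otherwise strong duality makes the values equal, possibly infinite. *)
Lemma duality_gap_eq0 (R : realType) (m n : nat) (A : 'M[R]_(m, n))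
    (b : 'cV[R]_m) (c : 'cV[R]_n) :
  duality_gap A b c = 0%E <->
  (exists x, primal_feasible A b x) \/ (exists y, dual_feasible A c y).
Proof.
rewrite /duality_gap; split=> [|/strong_duality ->]; last by rewrite eqxx.
move=> gap; apply: contrapT => /not_orP[/forallNP noP /forallNP noD].
move: gap; rewrite /primal_value /dual_value.
have -> : primal_feasible A b = classical_sets.set0.
  by apply/classical_sets.seteqP; split => x // /noP.
have -> : dual_feasible A c = classical_sets.set0.
  by apply/classical_sets.seteqP; split => y // /noD.
by rewrite !classical_sets.image_set0 ereal_inf0 ereal_sup0.
Qed.

(** * Feasibility over all scenarios *)

(** With p the sign vector of x, A_Delta diag(p) x = A_Delta |x|, and
    A_c x - A_Delta |x| is a lower bound of A x for every A in the interval.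
    Conversely A_c - A_Delta diag(p) has each entry at an endpoint. *)
Lemma weak_primal_feasible (R : realType) (m n : nat)
    (Alo Ahi : 'M[R]_(m, n)) (blo bhi : 'cV[R]_m) :
  mx_le Alo Ahi -> mx_le blo bhi ->
  (exists A b, [/\ mx_interval Alo Ahi A, mx_interval blo bhi b &
     exists x, primal_feasible A b x]) <->
  (exists p : 'rV[R]_n, (forall j, p 0 j = 1 \/ p 0 j = -1) /\
     exists x : 'cV[R]_n,
       mx_le ((mx_center Alo Ahi - mx_radius Alo Ahi *m diag_mx p) *m x) bhi).
Proof.
move=> hA hb; split.
  move=> [A [b [[AloA AAhi] [_ bbhi] [x Ax]]]].
  pose p : 'rV[R]_n := \row_j (if 0 <= x j 0 then 1 else -1).
  exists p; split=> [j|]; first by rewrite mxE; case: ifP; [left|right].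
  exists x => i j; apply: le_trans (bbhi i j); apply: le_trans (Ax i j).
  rewrite [j]ord1 !mxE; apply: ler_sum => k _.
  rewrite mul_mx_diag !mxE; move: (AloA i k) (AAhi i k).
  by case: ifP => [|/negbT]; rewrite -?ltNge => xk h1 h2; nra.
move=> [p [p1 [x px]]].
exists (mx_center Alo Ahi - mx_radius Alo Ahi *m diag_mx p), bhi.
split; last by exists x.
  split=> i j; rewrite mul_mx_diag !mxE; have := hA i j.
    by case: (p1 j) => ->; lra.
  by case: (p1 j) => ->; lra.
by split=> // i j.
Qed.

(** As y <= 0, the map A |-> A^T y is antitone, so A^T y lies in
    [Ahi^T y, Alo^T y].  If this box meets [clo, chi] in a point c, moving
    column j of A from Alo to Ahi by the right fraction t_j brings the j-th
    coordinate of A^T y to c_j. *)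
Lemma weak_dual_feasible (R : realType) (m n : nat)
    (Alo Ahi : 'M[R]_(m, n)) (clo chi : 'cV[R]_n) :
  mx_le Alo Ahi -> mx_le clo chi ->
  (exists A c, [/\ mx_interval Alo Ahi A, mx_interval clo chi c &
     exists y, dual_feasible A c y]) <->
  (exists y : 'cV[R]_m,
     [/\ mx_le (Ahi^T *m y) chi, mx_le clo (Alo^T *m y) & mx_le y 0]).
Proof.
have antitone (B C : 'M[R]_(m, n)) (y : 'cV[R]_m) : mx_le B C -> mx_le y 0 ->
    mx_le (C^T *m y) (B^T *m y).
  move=> BC y0 i j; rewrite !mxE; apply: ler_sum => k _; rewrite !mxE.
  by apply: ler_wnM2r; [have := y0 k j; rewrite mxE | exact: BC].
move=> hA hc; split.
  move=> [A [c [[AloA AAhi] [cloc cchi] [y [Ay y0]]]]].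
  exists y; split=> // i j.
    by apply: le_trans (cchi i j); rewrite -Ay; exact: antitone.
  by apply: (le_trans (cloc i j)); rewrite -Ay; exact: antitone.
move=> [y [ychi yclo y0]].
pose lo := Ahi^T *m y; pose hi := Alo^T *m y.
have lohi i : lo i 0 <= hi i 0 by exact: antitone.
pose c : 'cV[R]_n := \col_i Num.max (clo i 0) (lo i 0).
have c_lo i : lo i 0 <= c i 0 by rewrite [c _ _]mxE le_max lexx orbT.
have c_hi i : c i 0 <= hi i 0 by rewrite [c _ _]mxE ge_max lohi yclo.
(* If lo i = hi i, then t i = 0 by the convention 0^-1 = 0, and c i = hi i. *)
pose t i := (hi i 0 - c i 0) / (hi i 0 - lo i 0).
have t0 i : 0 <= t i by apply: divr_ge0; rewrite subr_ge0.
have t1 i : t i <= 1.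
  have := lohi i; rewrite le_eqVlt => /orP[/eqP e|lt].
    by rewrite /t e subrr invr0 mulr0.
  by rewrite /t ler_pdivrMr ?subr_gt0 // mul1r; have := c_lo i; lra.
have tE i : hi i 0 + t i * (lo i 0 - hi i 0) = c i 0.
  have := lohi i; rewrite le_eqVlt => /orP[/eqP e|lt].
    by have := c_lo i; have := c_hi i; rewrite e; lra.
  by rewrite /t; field; rewrite subr_eq0 gt_eqF.
pose A := \matrix_(i, j) (Alo i j + t j * (Ahi i j - Alo i j)).
exists A, c; split.
- split=> i j; rewrite mxE; move: (hA i j) (t0 j) (t1 j); nra.
- split=> i j; rewrite [j]ord1 [c _ _]mxE; first by rewrite le_max lexx.
  by rewrite ge_max hc ychi.
exists y; split=> //; apply/matrixP => i j; rewrite [j]ord1 -tE.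
rewrite /lo /hi !mxE -sumrB mulr_sumr -big_split /=.
by apply: eq_bigr => k _; rewrite !mxE; ring.
Qed.

Theorem corollary3 (R : realType) (m n : nat)
  (Alo Ahi : 'M[R]_(m, n)) (blo bhi : 'cV[R]_m) (clo chi : 'cV[R]_n)
  (hA : mx_le Alo Ahi) (hb : mx_le blo bhi) (hc : mx_le clo chi) :
  weakly_zero_duality_gap Alo Ahi blo bhi clo chi <->
  (exists p : 'rV[R]_n, (forall j, p 0 j = 1 \/ p 0 j = -1) /\
     exists x : 'cV[R]_n,
       mx_le ((mx_center Alo Ahi - mx_radius Alo Ahi *m diag_mx p) *m x) bhi)
  \/
  (exists y : 'cV[R]_m,
     [/\ mx_le (Ahi^T *m y) chi, mx_le clo (Alo^T *m y) & mx_le y 0]).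
Proof.
rewrite -(weak_primal_feasible hA hb) -(weak_dual_feasible hA hc); split.
  move=> [A [b [c [hA' hb' hc' /duality_gap_eq0[Px|Dy]]]]]; [left|right].
    by exists A, b.
  by exists A, c.
move=> [[A [b [hA' hb' Px]]]|[A [c [hA' hc' Dy]]]].
  exists A, b, clo; split=> //; first by split=> // i j.
  by apply/duality_gap_eq0; left.
exists A, blo, c; split=> //; first by split=> // i j.
by apply/duality_gap_eq0; right.
Qed.
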